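(* Let $G$ be a graph with $n$ vertices and $m$ edges such that its complement $\overline{G}$ is connected. Then $$S_1(\overline{G})\ \ge\ (n-1)\left[n(n-1)-2m\right]+\overline{M_1}(G)$$ and $$S_2(\overline{G})\ \ge\ (n-1)^2\left[\frac{n(n-1)}{2}-m\right]+(n-1)\overline{M_1}(G)+\overline{M_2}(G).$$ In each of these two inequalities, equality holds if and only if $\mathrm{diam}(\overline{G})\le 2$.
   Context: Graphs are finite and simple, with vertex set $V(G)$ and edge set $E(G)$; $d_G(u)$ is the degree of $u$ in $G$. For a connected graph $H$, $d_H(u,v)$ is the shortest-path distance, the status of a vertex is $\sigma_H(u)=\sum_{v\in V(H)}d_H(u,v)$, and $S_1(H)=\sum_{uv\in E(H)}[\sigma_H(u)+\sigma_H(v)]$, $S_2(H)=\sum_{uv\in E(H)}\sigma_H(u)\sigma_H(v)$. The Zagreb co-indices of a graph $G$ (not necessarily connected) are $\overline{M_1}(G)=\sum_{uv\notin E(G)}[d_G(u)+d_G(v)]$ and $\overline{M_2}(G)=\sum_{uv\notin E(G)}d_G(u)d_G(v)$, where the sums over $uv\notin E(G)$ range over unordered pairs of distinct non-adjacent vertices. *)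

(* Defs.v *)
From mathcomp Require Import all_boot all_order all_algebra.

Set Implicit Arguments.
Unset Strict Implicit.
Unset Printing Implicit Defensive.

(* A finite simple graph is a symmetric irreflexive relation on a finType;
   the theorem assumes both properties explicitly.  Edges are two-element
   sets of vertices. *)
Section Graph.

Variables (T : finType) (e : rel T).

Definition gcompl : rel T := [rel x y | (x != y) && ~~ e x y].

Definition gconnected : Prop := forall x y : T, connect e x y.

Definition edges : {set {set T}} :=
  [set [set p.1; p.2] | p : T * T & e p.1 p.2].

Definition nonedges : {set {set T}} :=
  [set A : {set T} | (#|A| == 2) && (A \notin edges)].

Definition deg (x : T) : nat := #|[set y | e x y]|.

(* In mathcomp, [path] allows repeated vertices; hence the [uniq] condition. *)
Definition has_path (x y : T) (k : nat) : bool :=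
  [exists p : k.-tuple T, [&& path e x p, last x p == y & uniq (x :: p)]].

(* The least k < #|T| such that a path with k edges joins x to y; paths have
   distinct vertices, so longer ones do not exist.  If x and y are not
   connected, the value is #|T|. *)
Definition dist (x y : T) : nat := find (has_path x y) (iota 0 #|T|).

Definition status (x : T) : nat := \sum_(y : T) dist x y.

Definition diam : nat := \max_(x : T) \max_(y : T) dist x y.

(* For A = {u, v} with u != v, the inner sum is f u + f v and the inner
   product is f u * f v. *)
Definition S1 : nat := \sum_(A in edges) \sum_(u in A) status u.
Definition S2 : nat := \sum_(A in edges) \prod_(u in A) status u.

Definition M1bar : nat := \sum_(A in nonedges) \sum_(u in A) deg u.
Definition M2bar : nat := \sum_(A in nonedges) \prod_(u in A) deg u.

End Graph.

(* Main.v *)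
(** In the complement, [dist x y] is at least [(x != y) + e x y], with equality
    exactly when it is at most 2.  Summing over [y], the status of [x] is at
    least [n - 1 + deg x], with equality when every vertex is within distance 2
    of [x].  The edges of the complement are the non-edges of [e]; summing over
    these gives both bounds.  By connectedness, every vertex lies on an edge as
    soon as [n > 1], which turns the edgewise equality condition into
    [diam <= 2]. *)

Require Import Defs.
From mathcomp Require Import all_boot all_order all_algebra.
From mathcomp Require Import ring lra.

Set Implicit Arguments.
Unset Strict Implicit.
Unset Printing Implicit Defensive.
Import Order.TTheory GRing.Theory Num.Theory.

Section Edges.

Variables (T : finType) (e : rel T).

Lemma edgesP (A : {set T}) :
  reflect (exists x y, e x y /\ A = [set x; y]) (A \in edges e).
Proof.
apply: (iffP imsetP) => [[[x y]]|[x [y [exy ->]]]].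
  by rewrite inE /= => exy ->; exists x, y.
by exists (x, y); rewrite ?inE.
Qed.

Lemma mem_edges (x y : T) :
  symmetric e -> ([set x; y] \in edges e) = e x y.
Proof.
move=> e_sym; apply/edgesP/idP => [[u [v [euv eq_xy]]]|exy]; last first.
  by exists x, y.
(* Equal sets match [(x, y)] with [(u, v)] up to a swap, which symmetry absorbs. Loops are allowed
   here, so if [x] and [y] both equal one endpoint, the other endpoint must coincide with it. *)
have /set2P[xu|xv] : x \in [set u; v] by rewrite -eq_xy set21.
  have /set2P[yu|yv] : y \in [set u; v] by rewrite -eq_xy set22.
    have /set2P[vx|vy] : v \in [set x; y] by rewrite eq_xy set22.
      by rewrite xu yu -{2}xu -vx.
    by rewrite xu -vy.
  by rewrite xu yv.
have /set2P[yu|yv] : y \in [set u; v] by rewrite -eq_xy set22.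
  by rewrite xv yu e_sym.
have /set2P[ux|uy] : u \in [set x; y] by rewrite eq_xy set21.
  by rewrite yv -ux.
by rewrite xv -uy e_sym.
Qed.

Lemma card_nonedge (A : {set T}) : A \in nonedges e -> #|A| = 2.
Proof. by rewrite inE => /andP[/eqP]. Qed.

(** Irreflexivity makes every edge a genuine pair, so membership in [edges e] splits the two-element
    subsets of [T] into these two families. *)
Lemma card_nonedges :
  irreflexive e -> #|nonedges e| + #|edges e| = 'C(#|T|, 2).
Proof.
move=> e_irr; rewrite -card_draws -[RHS](cardsID (edges e)) addnC; congr (_ + _).
  apply: eq_card => A; rewrite !inE andbC.
  case: edgesP => // -[x [y [exy ->]]].
  by rewrite cards2 (_ : x != y) //; apply: contraTneq exy => ->; rewrite e_irr.
by apply: eq_card => A; rewrite !inE andbC.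
Qed.

End Edges.

Lemma edges_gcompl (T : finType) (e : rel T) :
  symmetric e -> edges (gcompl e) = nonedges e.
Proof.
move=> e_sym; apply/setP => A; apply/edgesP/idP.
  move=> [x [y [/andP[neq_xy nexy] ->]]].
  by rewrite inE cards2 neq_xy mem_edges.
rewrite inE => /andP[/cards2P[x [y [neq_xy ->]]]]; rewrite mem_edges // => nexy.
by exists x, y; split=> //; apply/andP.
Qed.

Section Distance.

Variables (T : finType) (e : rel T).

Lemma has_path0 (x y : T) : has_path e x y 0 = (x == y).
Proof.
apply/existsP/idP => [[p]|/eqP ->]; first by rewrite tuple0 andbT.
by exists [tuple]; rewrite /= eqxx.
Qed.

Lemma has_path1 (x y : T) : has_path e x y 1 = (x != y) && e x y.
Proof.
apply/existsP/andP => [[p]|[neq_xy exy]].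
  case/tupleP: p => z p; rewrite tuple0 /= !inE !andbT.
  by case/and3P => exz /eqP <- neq_xz.
by exists [tuple y]; rewrite /= !inE exy neq_xy eqxx.
Qed.

Lemma card1_dist (x y : T) :
  #|T| <= 1 -> dist e x y = 0.
Proof.
move=> T1; have /card_le1_eqP/(_ x y isT isT) -> : #|T| <= 1 by [].
have : 0 < #|T| by apply/card_gt0P; exists x.
by rewrite /dist; case: #|T| => // n _; rewrite /= has_path0 eqxx.
Qed.

Lemma diam_leqP (k : nat) :
  reflect (forall x y, dist e x y <= k) (diam e <= k).
Proof.
apply: (iffP idP) => [/bigmax_leqP dk x y|dk].
  by have /bigmax_leqP := dk x isT; apply.
by apply/bigmax_leqP => x _; apply/bigmax_leqP => y _.
Qed.

(** A path from [x] to any other vertex is nonempty, and its first step is the required edge. *)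
Lemma gconnected_edge (x : T) :
  gconnected e -> 1 < #|T| -> exists y, e x y.
Proof.
move=> e_conn; rewrite (cardD1 x) inE /= add1n ltnS => /card_gt0P[z].
rewrite !inE andbT => neq_zx.
have /connectP[[|y p] /=] := e_conn x z.
  by move=> _ zx; rewrite zx eqxx in neq_zx.
by case/andP => exy _ _; exists y.
Qed.

End Distance.

Lemma dist_gcompl_leqif (T : finType) (e : rel T) (x y : T) : irreflexive e ->
  (x != y) + e x y <= dist (gcompl e) x y ?= iff (dist (gcompl e) x y <= 2).
Proof.
move=> e_irr; rewrite /dist.
have [<-|neq_xy] := eqVneq x y.
  have : 0 < #|T| by apply/card_gt0P; exists x.
  by case: #|T| => // n _; rewrite /= has_path0 eqxx e_irr.
(* With at least two vertices, [find] tests both lengths 0 and 1. Length 0 fails and length 1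
   succeeds exactly on non-edges of [e]; otherwise the result is at least 2, even when it is the
   default [#|T|]. *)
have : 1 < #|T| by rewrite (cardD1 x) (cardD1 y) !inE eq_sym neq_xy.
case: #|T| => [|[|n]] // _.
rewrite /= has_path0 has_path1 (negPf neq_xy) /gcompl /= neq_xy /=.
by case: (e x y); split; rewrite //= !eqSS !ltnS leqn0 eq_sym.
Qed.

Lemma status_gcompl_leqif (T : finType) (e : rel T) (x : T) : irreflexive e ->
  #|T|.-1 + deg e x <= status (gcompl e) x
    ?= iff [forall y, dist (gcompl e) x y <= 2].
Proof.
move=> e_irr.
have -> : #|T|.-1 + deg e x = \sum_y ((x != y) + e x y).
  rewrite big_split /=; congr (_ + _).
    rewrite -big_mkcond sum1_card -(cardC1 x).
    by apply: eq_card => y; rewrite !inE unfold_in eq_sym.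
  by rewrite -big_mkcond sum1dep_card.
exact: leqif_sum (fun y _ => dist_gcompl_leqif x y e_irr).
Qed.

Lemma diam_gcompl_leq2 (T : finType) (e : rel T) :
  symmetric e -> gconnected (gcompl e) ->
  [forall (A | A \in nonedges e),
     [forall (u | u \in A), [forall y, dist (gcompl e) u y <= 2]]]
  = (diam (gcompl e) <= 2).
Proof.
move=> e_sym e_conn; apply/idP/diam_leqP => [ecc x y|dist2].
  (* With at most one vertex there are no non-edges, so [ecc] is vacuous and the distance has to be
     bounded directly. *)
  have [T1|T2] := leqP #|T| 1; first by rewrite card1_dist.
  have [z cxz] := gconnected_edge x e_conn T2.
  have xzP : [set x; z] \in nonedges e.
    by rewrite -edges_gcompl //; apply/edgesP; exists x, z.
  move/forall_inP/(_ _ xzP)/forall_inP/(_ x (set21 x z)) in ecc.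
  exact: (forallP ecc).
by apply/forall_inP => A _; apply/forall_inP => u _; apply/forallP.
Qed.

Section NonedgeSums.

Variables (T : finType) (e : rel T).
Hypothesis e_irr : irreflexive e.

Let b (u : T) := #|T|.-1 + deg e u.
Let ecc2 (u : T) := [forall y, dist (gcompl e) u y <= 2].

Lemma sum_status_leqif :
  \sum_(A in nonedges e) \sum_(u in A) b u
    <= \sum_(A in nonedges e) \sum_(u in A) status (gcompl e) u
    ?= iff [forall (A | A \in nonedges e), [forall (u | u \in A), ecc2 u]].
Proof.
apply: leqif_sum => A _; apply: leqif_sum => u _.
exact: status_gcompl_leqif.
Qed.

(** Equality of products gives equality of factors only when the products are nonzero. A non-edge
    has two distinct vertices, so [#|T|.-1] is positive, and hence so are both statuses. *)
Lemma prod_status_leqif :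
  \sum_(A in nonedges e) \prod_(u in A) b u
    <= \sum_(A in nonedges e) \prod_(u in A) status (gcompl e) u
    ?= iff [forall (A | A \in nonedges e), [forall (u | u \in A), ecc2 u]].
Proof.
apply: leqif_sum => A /card_nonedge/eqP/cards2P[x [y [neq_xy ->]]].
rewrite !big_setU1 ?inE //= !big_set1.
have st_x := status_gcompl_leqif x e_irr.
have st_y := status_gcompl_leqif y e_irr.
have T2 : 0 < #|T|.-1 by rewrite (cardD1 x) (cardD1 y) !inE eq_sym neq_xy.
have pos u : 0 < b u by rewrite /b addn_gt0 T2.
have -> : [forall (u | u \in [set x; y]), ecc2 u] = ecc2 x && ecc2 y.
  apply/forall_inP/andP => [ecc|[eccx eccy] u /set2P[] -> //].
  by split; apply: ecc; rewrite !inE eqxx ?orbT.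
(* This excludes the alternative equality case of [leqif_mul], a vanishing upper product. *)
have /negPf st0 : status (gcompl e) x * status (gcompl e) y != 0.
  rewrite -lt0n muln_gt0.
  by rewrite (leq_trans (pos x) st_x.1)
             (leq_trans (pos y) st_y.1).
by have := leqif_mul st_x st_y; rewrite st0.
Qed.

End NonedgeSums.

Section PairSums.

Local Open Scope ring_scope.

Variables (R : comNzRingType) (T : finType) (S : {set {set T}}).
Hypothesis pairS : forall A, A \in S -> #|A| = 2.
Variables (a : R) (f : T -> R).

Lemma pair_sum_shift :
  \sum_(A in S) \sum_(u in A) (a + f u)
  = #|S|%:R * (2 * a) + \sum_(A in S) \sum_(u in A) f u.
Proof.
rewrite mulr_natl -sumr_const -big_split /=; apply: eq_bigr => A /pairS A2.
by rewrite big_split /= sumr_const A2 mulr_natl.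
Qed.

(** Expanding [(a + f x) * (a + f y)] yields three terms; for [a = n - 1] and [f] the degree they
    become the three terms of the bound on [S2]. *)
Lemma pair_prod_shift :
  \sum_(A in S) \prod_(u in A) (a + f u)
  = #|S|%:R * a ^+ 2 + a * (\sum_(A in S) \sum_(u in A) f u)
    + \sum_(A in S) \prod_(u in A) f u.
Proof.
rewrite mulr_natl -sumr_const mulr_sumr -!big_split /=.
apply: eq_bigr => A /pairS/eqP/cards2P[x [y [neq_xy ->]]].
by rewrite !big_setU1 ?inE //= !big_set1; ring.
Qed.

End PairSums.

Local Open Scope ring_scope.

Theorem proposition2p4 (T : finType) (e : rel T) (n m : nat)
    (e_sym : symmetric e) (e_irr : irreflexive e)
    (hn : #|T| = n) (hm : #|edges e| = m)
    (hconn : gconnected (gcompl e)) :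
  ((S1 (gcompl e))%:R >=
     (n%:R - 1) * (n%:R * (n%:R - 1) - 2 * m%:R) + (M1bar e)%:R :> rat
   /\ ((S1 (gcompl e))%:R =
         (n%:R - 1) * (n%:R * (n%:R - 1) - 2 * m%:R) + (M1bar e)%:R :> rat
       <-> (diam (gcompl e) <= 2)%N))
  /\
  ((S2 (gcompl e))%:R >=
     (n%:R - 1) ^+ 2 * (n%:R * (n%:R - 1) / 2 - m%:R)
       + (n%:R - 1) * (M1bar e)%:R + (M2bar e)%:R :> rat
   /\ ((S2 (gcompl e))%:R =
         (n%:R - 1) ^+ 2 * (n%:R * (n%:R - 1) / 2 - m%:R)
           + (n%:R - 1) * (M1bar e)%:R + (M2bar e)%:R :> rat
       <-> (diam (gcompl e) <= 2)%N)).
Proof.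
have predn_rat (u : T) :
    (#|T|.-1 + deg e u)%:R = n%:R - 1 + (deg e u)%:R :> rat.
  (* The vertex [u] rules out [n = 0], where the truncated predecessor differs from [n - 1]. Below,
     this identity is used only under a sum or product over vertices, which supplies [u]. *)
  have T0 : (0 < #|T|)%N by apply/card_gt0P; exists u.
  by rewrite natrD -hn -subn1 natrB.
have card_ne : (#|nonedges e|)%:R = n%:R * (n%:R - 1) / 2 - m%:R :> rat.
  have bin2R : 'C(n, 2)%:R = n%:R * (n%:R - 1) / 2 :> rat.
    (* The identity is [n * 'C(n.-1, 1) = 2 * 'C(n, 2)]; truncation again makes [n = 0] a separate
       case. *)
    have := congr1 (fun k : nat => k%:R : rat) (mul_bin_diag n 1).
    case: (n) => [|k]; first by rewrite bin0n !mul0r.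
    by rewrite bin1 !natrM /= -natr1; lra.
  by rewrite -bin2R -hn -(card_nonedges e_irr) hm natrD; ring.
have M1E : (\sum_(A in nonedges e) \sum_(u in A) (#|T|.-1 + deg e u))%:R
    = (n%:R - 1) * (n%:R * (n%:R - 1) - 2 * m%:R) + (M1bar e)%:R :> rat.
  rewrite /M1bar !natr_sum.
  under eq_bigr => A _ do
    (rewrite natr_sum; under eq_bigr => u _ do rewrite predn_rat).
  under [X in _ = _ + X]eq_bigr => A _ do rewrite natr_sum.
  by rewrite (pair_sum_shift (@card_nonedge _ e)) card_ne; field.
have M2E : (\sum_(A in nonedges e) \prod_(u in A) (#|T|.-1 + deg e u))%:R
    = (n%:R - 1) ^+ 2 * (n%:R * (n%:R - 1) / 2 - m%:R)
       + (n%:R - 1) * (M1bar e)%:R + (M2bar e)%:R :> rat.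
  rewrite /M1bar /M2bar !natr_sum.
  under eq_bigr => A _ do
    (rewrite natr_prod; under eq_bigr => u _ do rewrite predn_rat).
  under [X in _ = _ + _ * X + _]eq_bigr => A _ do rewrite natr_sum.
  under [X in _ = _ + X]eq_bigr => A _ do rewrite natr_prod.
  by rewrite (pair_prod_shift (@card_nonedge _ e)) card_ne; ring.
(* Both rational bounds become casts of natural sums over non-edges, so the claims reduce to the two
   [leqif] statements. *)
rewrite -M1E -M2E /S1 /S2 edges_gcompl // -(diam_gcompl_leq2 e_sym hconn).
have [le1 eq1] := sum_status_leqif e_irr.
have [le2 eq2] := prod_status_leqif e_irr.
split; (split; first by rewrite ler_nat).
  by rewrite -eq1; split => [/eqP|/eqP ->//]; rewrite eqr_nat eq_sym.
by rewrite -eq2; split => [/eqP|/eqP ->//]; rewrite eqr_nat eq_sym.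
Qed.
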